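(* Let $X$ be a coarse space and let $n\ge 0$ be an integer. If $X$ is of asymptotic dimension at most $n$, then for every $\epsilon>0$ and every uniformly bounded cover $\mathcal{U}$ of $X$ there are $\delta>0$ and a uniformly bounded cover $\mathcal{V}$ of $X$ such that the following holds: for every simplicial complex $K$, every subset $A\subset X$, every $(\mathcal{V},\delta)$-partition of unity $f\colon X\to K$ and every function $g\colon A\to K^{(n)}$ such that $f|_A=i\circ g$, where $i\colon K^{(n)}\to K$ is the inclusion, there is a filler $h\colon X\to K^{(n)}$ that is a $(\mathcal{U},\epsilon)$-partition of unity. Here $h$ being a filler means that $h|_A=g$ and that, for every $x\in X$ and every simplex $\Delta$ of $K$, $f(x)\in\Delta$ implies $h(x)\in\Delta$.
   Context: Coarse spaces. A coarse space is a set $X$ with a large scale structure: a nonempty collection of families of subsets of $X$, called uniformly bounded families, such that (1) if $\mathcal{B}_1$ is uniformly bounded and every element of $\mathcal{B}_2$ with more than one point is contained in some element of $\mathcal{B}_1$, then $\mathcal{B}_2$ is uniformly bounded; (2) if $\mathcal{B}_1,\mathcal{B}_2$ are uniformly bounded then so is $\{st(B,\mathcal{B}_2) : B\in\mathcal{B}_1\}$, where $st(B,\mathcal{B}_2)$ is the union of all elements of $\mathcal{B}_2$ intersecting $B$. (This is equivalent to Roe's coarse structures: $\mathcal{B}$ is uniformly bounded iff $\bigcup_{B\in\mathcal{B}}B\times B$ is controlled.) Asymptotic dimension. $X$ has asymptotic dimension at most $n$ if for every uniformly bounded cover $\mathcal{U}$ of $X$ there is a uniformly bounded cover $\mathcal{V}$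 of $X$ such that every element $U$ of $\mathcal{U}$ intersects at most $n+1$ elements of $\mathcal{V}$. Simplicial complexes. For a set $S$, the full complex $\Delta(S)$ is the set of finitely supported functions $f\colon S\to[0,1]$ with $\sum_{s\in S}f(s)=1$, with the metric inherited from $l^1(S)$. A simplicial complex $K$ is a subcomplex of some $\Delta(S)$, with the induced $l^1$-metric; $K^{(0)}$ is its set of vertices and $K^{(n)}$ its $n$-skeleton. The star $st(v)$ of a vertex $v$ is the set of all $f\in K$ with $f(v)>0$. Any function $f\colon X\to K$ is viewed as a point-finite partition of unity $\{f_v\}_{v\in K^{(0)}}$, $f_v(x):=f(x)(v)$. $(\mathcal{U},\epsilon)$-partitions of unity. For a cover $\mathcal{U}$ of $X$ and a function $f$ from $X$ to a metric space, $var_{\mathcal{U}}(f)$ is the supremum of $d(f(x),f(y))$ over all $x,y$ contained in a common element of $\mathcal{U}$. A function $f\colon X\to K$ is a $(\mathcal{U},\epsilon)$-partition of unity if: (i) $var_{\mathcal{U}}(f)<\epsilon$; (ii) for every $U\in\mathcal{U}$ there is $v\in K^{(0)}$ with $f_v(y)>0$ for all $y\in U$; (iii) $\{f^{-1}(st(v))\}_{v\in K^{(0)}}$ is a uniformly bounded cover of $X$. *)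

(* Defs.v *)
From mathcomp Require Import all_boot all_order all_algebra.
From mathcomp Require Import all_classical all_reals all_analysis.

Set Implicit Arguments.
Unset Strict Implicit.
Unset Printing Implicit Defensive.

Import Order.TTheory GRing.Theory Num.Theory.

Local Open Scope classical_set_scope.
Local Open Scope card_scope.
Local Open Scope ring_scope.

Section CoarseSpaces.
Context {X : Type}.
Implicit Types (B C : set X) (U V : set (set X)).

Definition family_star B U : set X := \bigcup_(C in U `&` [set C | C `&` B !=set0]) C.

Definition is_cover U : Prop := \bigcup_(B in U) B = [set: X].

End CoarseSpaces.

Record large_scale_structure (X : Type) := LargeScaleStructure {
  unif_bounded : set (set (set X));
  unif_bounded_neq0 : unif_bounded !=set0;
  (* [~ is_subset1 B] says that B has more than one point *)
  unif_bounded_refine : forall U V : set (set X), unif_bounded U ->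
    (forall B, V B -> ~ is_subset1 B -> exists2 C, U C & B `<=` C) ->
    unif_bounded V;
  unif_bounded_star : forall U V : set (set X),
    unif_bounded U -> unif_bounded V ->
    unif_bounded [set family_star B V | B in U]
}.

Definition unif_bounded_cover {X : Type} (L : large_scale_structure X)
    (U : set (set X)) : Prop :=
  unif_bounded L U /\ is_cover U.

Definition asdim_le {X : Type} (L : large_scale_structure X) (n : nat) : Prop :=
  forall U, unif_bounded_cover L U ->
  exists2 V, unif_bounded_cover L V &
    forall B, U B -> V `&` [set C | C `&` B !=set0] #<= `I_n.+1.

Section SimplicialComplexes.
Context {R : realType} {S : choiceType}.
Implicit Types (p q : S -> R) (K : set (S -> R)) (s : set S) (v : S).

Definition supp p : set S := [set v | p v != 0].

Definition full_complex : set (S -> R) :=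
  [set p | [/\ finite_set (supp p),
               forall v, 0 <= p v <= 1 &
               \sum_(v \in [set: S]) p v = 1]].

(* The finitely supported sum has value 0 when the family has infinite support;
   this does not happen for p, q in the full complex. *)
Definition l1dist p q : R := \sum_(v \in [set: S]) `|p v - q v|.

(* The closed simplex of the full complex with vertex set s. *)
Definition simplex s : set (S -> R) := full_complex `&` [set p | supp p `<=` s].

(* A simplex is encoded by its vertex set, a nonempty finite subset of S. *)
Definition is_simplex s : Prop := finite_set s /\ s !=set0.

Definition simplicial_complex K : Prop :=
  exists2 F : set (set S), F `<=` is_simplex & K = \bigcup_(s in F) simplex s.

Definition simplices K : set (set S) :=
  [set s | is_simplex s /\ simplex s `<=` K].

(* The vertex v is identified with the point [\1_[set v]] of the complex. *)
Definition vertices K : set S := [set v | K (\1_[set v])].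

Definition skeleton (n : nat) K : set (S -> R) :=
  \bigcup_(s in simplices K `&` [set s | s #<= `I_n.+1]) simplex s.

Definition vertex_star K v : set (S -> R) := K `&` [set p | 0 < p v].

End SimplicialComplexes.

(* The supremum is taken in the extended reals, so that no boundedness
   condition is needed. *)
Definition cover_variation {R : realType} {X M : Type} (d : M -> M -> R)
    (U : set (set X)) (f : X -> M) : \bar R :=
  ereal_sup [set r | exists B x y, [/\ U B, B x, B y & r = (d (f x) (f y))%:E]].

Definition is_partition_of_unity {R : realType} {S : choiceType} {X : Type}
    (L : large_scale_structure X) (U : set (set X)) (eps : R)
    (K : set (S -> R)) (f : X -> S -> R) : Prop :=
  [/\ set_fun [set: X] K f,
      (cover_variation l1dist U f < eps%:E)%E,
      forall B, U B -> exists2 v, vertices K v & forall y, B y -> 0 < f y v &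
      unif_bounded_cover L [set f @^-1` vertex_star K v | v in vertices K]].

Definition is_filler {R : realType} {S : choiceType} {X : Type}
    (K : set (S -> R)) (A : set X) (f g h : X -> S -> R) : Prop :=
  (forall x, A x -> h x = g x) /\
  (forall x s, simplices K s -> simplex s (f x) -> simplex s (h x)).

(* Main.v *)
Require Import Defs.
From mathcomp Require Import all_boot all_order all_algebra.
From mathcomp Require Import all_classical all_reals all_analysis.
From mathcomp Require Import finmap ring lra.

Set Implicit Arguments.
Unset Strict Implicit.
Unset Printing Implicit Defensive.

Import Order.TTheory GRing.Theory Num.Theory.

Local Open Scope classical_set_scope.
Local Open Scope ring_scope.

(** The filler interpolates between two maps into the n-skeleton, both of which
    stay in the simplex spanned by [f x].

    Far from [A], asymptotic dimension at most n yields a uniformly bounded cover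
    [W] whose m-fold stars (taken with respect to [U]) overlap at most n+1 times
    ([asdim_star_cover]). Tent functions around the elements of [W] form a slowly
    varying partition of unity ([tent_lip]). If [V] is coarse enough to contain the
    2m-fold stars of the elements of [W], then the Lebesgue property of [f] gives
    each element [C] of [W] a vertex [w C] at which [f] is positive on the m-fold
    star of [C]; sending [C] to [w C] gives the usual map through the nerve of [W],
    and at most n+1 vertices are used at each point.

    Near [A], let [a x] be a point of [A] close to [x]. The pointwise minimum of
    [f x] and [f (a x)] (the [hub] of [x]) is close to [f x], equals [f x] on [A],
    and is supported on at most n+1 vertices because [f (a x)] lies in the
    n-skeleton.

    On the collar around [A] the two maps must be joined without leaving the
    n-skeleton. This works because for [C] close to [A] the vertex [w C] can be
    taken to be one with coordinate at least 1/(n+1) at some point of [A] near [C]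
    ([dominant_vertex]). When delta is below 1/(2(n+1)), this vertex stays positive
    at all nearby points ([heavy_vertex_persists]), hence it belongs to the support
    of the hub of every [x] in the star of [C]. So the two maps are contiguous: the
    nerve map takes values in the simplex spanned by the hub, and every convex
    combination of the two is supported in at most n+1 vertices
    ([supp_blend_card]). The interpolation parameter is the tent function around
    [A], which equals 1 on [A] and vanishes outside its m-fold star. The result has
    mass at least 1/2, so that normalizing it multiplies its variation by at most 4
    ([l1dist_normalize]). *)

(** * Finitely supported functions and the l1 distance *)

Section Mass.
Context {R : realType} {S : choiceType}.
Implicit Types p q r : S -> R.

(** Defined so that [l1dist p q] is literally the mass of [fun v => `|p v - q v|]. *)
Definition mass p : R := \sum_(v \in [set: S]) p v.

Lemma mass_fset (A : {fset S}) p :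
  supp p `<=` [set` A] -> mass p = \sum_(v <- A) p v.
Proof.
move=> sA; rewrite /mass (fsbigTE A)// => v vA.
by apply/eqP; apply: contraNT vA => pv0; exact: sA.
Qed.

Lemma supp_sub2 p q r : (forall v, p v = 0 -> q v = 0 -> r v = 0) ->
  supp r `<=` supp p `|` supp q.
Proof.
move=> pqr v; apply: contraPP => /not_orP[].
move=> /negP; rewrite negbK => /eqP p0 /negP; rewrite negbK => /eqP q0.
by apply/negP; rewrite negbK pqr.
Qed.

Lemma finite_supp2 p q r : finite_set (supp p) -> finite_set (supp q) ->
  (forall v, p v = 0 -> q v = 0 -> r v = 0) -> finite_set (supp r).
Proof.
by move=> fp fq /supp_sub2 /sub_finite_set; apply; rewrite finite_setU.
Qed.

Lemma supp_fset_set p (D : set S) : finite_set D -> supp p `<=` D ->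
  supp p `<=` [set` fset_set D].
Proof. by move=> fD pD; rewrite fset_setK. Qed.

Lemma massD p q : finite_set (supp p) -> finite_set (supp q) ->
  mass (fun v => p v + q v) = mass p + mass q.
Proof.
move=> fp fq; have fD : finite_set (supp p `|` supp q) by rewrite finite_setU.
rewrite !(@mass_fset (fset_set (supp p `|` supp q))) ?big_split//.
- exact: supp_fset_set.
- exact: supp_fset_set.
- apply: supp_fset_set => //; apply: supp_sub2 => v -> ->.
  exact: addr0.
Qed.

Lemma massZ c p : mass (fun v => c * p v) = c * mass p.
Proof. by rewrite /mass mulr_fsumr. Qed.

Lemma le_mass p q : finite_set (supp p) -> finite_set (supp q) ->
  (forall v, p v <= q v) -> mass p <= mass q.
Proof.
move=> fp fq pq; have fD : finite_set (supp p `|` supp q) by rewrite finite_setU.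
rewrite !(@mass_fset (fset_set (supp p `|` supp q))) ?ler_sum//.
  exact: supp_fset_set.
exact: supp_fset_set.
Qed.

Lemma mass_ge0 p : (forall v, 0 <= p v) -> 0 <= mass p.
Proof. by move=> p0; apply: fsumr_ge0. Qed.

Lemma mass_le_card (D : set S) (k : nat) c p : supp p `<=` D ->
  (D #<= `I_k)%card -> 0 <= c -> (forall v, p v <= c) -> mass p <= k%:R * c.
Proof.
move=> pD Dk c0 pc; have fD : finite_set D by apply/finite_set_leP; exists k.
rewrite (@mass_fset (fset_set D)); last exact: supp_fset_set.
have kD := geq_card_fset_set Dk.
apply: (@le_trans _ _ (\sum_(v <- fset_set D) c)); first exact: ler_sum.
rewrite big_const_seq count_predT iter_addr_0 -[X in X <= _]mulr_natl.
by rewrite ler_wpM2r// ler_nat.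
Qed.

Lemma coord_le_mass p v : finite_set (supp p) -> (forall v, 0 <= p v) ->
  p v <= mass p.
Proof.
move=> fp p0; have fD : finite_set (supp p `|` [set v]) by rewrite finite_setU.
rewrite (@mass_fset (fset_set (supp p `|` [set v]))); last exact: supp_fset_set.
rewrite (big_fsetD1 v)/= ?lerDl ?sumr_ge0//.
by rewrite in_fset_set//; apply/mem_set; right.
Qed.

End Mass.

Section Normalization.
Context {R : realType} {S : choiceType}.
Implicit Types (p q : S -> R) (v : S).

Definition normalize p : S -> R := fun v => p v / mass p.

Lemma finite_supp_dist p q : finite_set (supp p) -> finite_set (supp q) ->
  finite_set (supp (fun v => `|p v - q v|)).
Proof.
move=> fp fq; apply: (finite_supp2 fp fq) => v -> ->.
by rewrite subrr normr0.
Qed.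

Lemma finite_supp_min p q : finite_set (supp p) -> finite_set (supp q) ->
  finite_set (supp (fun v => Num.min (p v) (q v))).
Proof.
by move=> fp fq; apply: (finite_supp2 fp fq) => v -> ->; exact: minxx.
Qed.

Lemma coord_le_l1dist p q v : finite_set (supp p) -> finite_set (supp q) ->
  `|p v - q v| <= l1dist p q.
Proof.
move=> fp fq; apply: (coord_le_mass v (finite_supp_dist fp fq)) => w.
exact: normr_ge0.
Qed.

Lemma mass_le_l1dist p q : finite_set (supp p) -> finite_set (supp q) ->
  `|mass p - mass q| <= l1dist p q.
Proof.
move=> fp fq; have fD : finite_set (supp p `|` supp q) by rewrite finite_setU.
rewrite /l1dist -[leRHS]/(mass _).
rewrite !(@mass_fset _ _ (fset_set (supp p `|` supp q))).
- by rewrite -sumrB ler_norm_sum.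
- apply: supp_fset_set => //; apply: supp_sub2 => v -> ->.
  by rewrite subrr normr0.
- exact: supp_fset_set.
- exact: supp_fset_set.
Qed.

(** Cutting [p] down to a nearby [q] costs no more than moving to [q], while the
    result keeps its support inside both supports. *)
Lemma l1dist_min p q : finite_set (supp p) -> finite_set (supp q) ->
  l1dist p (fun v => Num.min (p v) (q v)) <= l1dist p q.
Proof.
move=> fp fq; apply: le_mass.
- exact/finite_supp_dist/finite_supp_min.
- exact: finite_supp_dist.
- move=> v; case: (leP (p v) (q v)) => // _.
  by rewrite subrr normr0.
Qed.

Lemma full_complex_normalize p : finite_set (supp p) -> (forall v, 0 <= p v) ->
  0 < mass p -> full_complex (normalize p).
Proof.
move=> fp p0 mp; split.
- by apply: (finite_supp2 fp fp) => v pv _; rewrite /normalize pv mul0r.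
- move=> v; rewrite divr_ge0 ?(ltW mp)//= ler_pdivrMr// mul1r.
  exact: coord_le_mass.
- rewrite -[LHS]/(mass _) -(@divff _ (mass p)) ?gt_eqF// mulrC -massZ.
  by apply: eq_fsbigr => v _; rewrite mulrC.
Qed.

(** With [P] and [Q] the masses, [p/P - q/Q = (p - q)/P + q (1/P - 1/Q)], and the
    mass of the last term is [|P - Q|/P], again at most [l1dist p q / P]. *)
Lemma l1dist_normalize p q : finite_set (supp p) -> finite_set (supp q) ->
  (forall v, 0 <= q v) -> 2^-1 <= mass p -> 0 < mass q ->
  l1dist (normalize p) (normalize q) <= 4 * l1dist p q.
Proof.
move=> fp fq q0 mp mq; have mp0 : 0 < mass p by apply: lt_le_trans mp.
have fpq := finite_supp_dist fp fq.
pose c := `|(mass p)^-1 - (mass q)^-1|.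
have dist_ge0 : 0 <= l1dist p q by apply: mass_ge0 => v; exact: normr_ge0.
apply: (@le_trans _ _
  (mass (fun v => (mass p)^-1 * `|p v - q v| + c * q v))).
  apply: le_mass.
  - by apply: (finite_supp2 fp fq) => v pv qv;
      rewrite /normalize pv qv !mul0r subrr normr0.
  - by apply: (finite_supp2 fp fq) => v pv qv;
      rewrite pv qv subrr normr0 !mulr0 addr0.
  - move=> v; rewrite /normalize.
    have -> : p v / mass p - q v / mass q =
      (mass p)^-1 * (p v - q v) + ((mass p)^-1 - (mass q)^-1) * q v by ring.
    rewrite (le_trans (ler_normD _ _))// !normrM (ger0_norm (q0 v)).
    by rewrite (gtr0_norm (_ : 0 < (mass p)^-1)) ?invr_gt0.
rewrite massD; last 2 first.
- by apply: (finite_supp2 fpq fpq) => v -> _; rewrite mulr0.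
- by apply: (finite_supp2 fq fq) => v -> _; rewrite mulr0.
rewrite !massZ -[mass (fun v => `|_|)]/(l1dist p q).
have -> : c * mass q = (mass p)^-1 * `|mass p - mass q|.
  rewrite /c -[X in _ * X](gtr0_norm mq) -normrM distrC.
  rewrite -[X in X * `|_|](gtr0_norm (_ : 0 < (mass p)^-1)) ?invr_gt0// -normrM.
  by congr `|_|; field; rewrite !gt_eqF.
rewrite -mulrDr.
have mpV : (mass p)^-1 <= 2 by rewrite invf_ple// posrE.
have := mass_le_l1dist fp fq => mpq.
rewrite (_ : 4 * _ = 2 * (l1dist p q + l1dist p q)); last by ring.
apply: ler_pM => //; first by rewrite invr_ge0 ltW.
  by rewrite addr_ge0.
by rewrite lerD2l.
Qed.

Lemma supp_normalize p : supp (normalize p) `<=` supp p.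
Proof.
move=> v; apply: contraPP => /negP; rewrite negbK => /eqP p0.
by apply/negP; rewrite negbK /normalize p0 mul0r.
Qed.

Lemma normalize_id p : full_complex p -> normalize p = p.
Proof.
move=> [_ _ p1]; apply/funext => v.
by rewrite /normalize [mass p]p1 divr1.
Qed.

End Normalization.

(** * Iterated stars *)

Section IteratedStars.
Context {X : Type} (U : set (set X)).
Implicit Types (B G H : set X) (x y : X).

Lemma mem_cover x : is_cover U -> exists2 B, U B & B x.
Proof.
by move=> cU; have [B UB Bx] : (\bigcup_(B in U) B) x by [rewrite cU]; exists B.
Qed.

Definition star_iter (m : nat) (G : set X) : set X :=
  iter m (fun H => family_star H U) G.

Lemma star_iterS_mem m G B x y :
  U B -> B x -> B y -> star_iter m G x -> star_iter m.+1 G y.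
Proof. by move=> UB Bx By Gx; exists B => //; split=> //; exists x. Qed.

Lemma star_iterS m G x : star_iter m.+1 G x ->
  exists B y, [/\ U B, B x, B y & star_iter m G y].
Proof. by move=> [B [UB [y [By Gy]]] Bx]; exists B, y. Qed.

Lemma star_iter_bigcup {I : Type} m (D : set I) (F : I -> set X) x :
  star_iter m (\bigcup_(i in D) F i) x -> exists2 i, D i & star_iter m (F i) x.
Proof.
elim: m x => [x [i Di Fx]|m IH x /star_iterS[B [y [UB Bx By /IH[i Di Fy]]]]].
  by exists i.
by exists i => //; apply: (star_iterS_mem UB By Bx Fy).
Qed.

(** Stars are symmetric: a chain of [j] elements of [U] from [x] back to [H]
    prolongs the chain of [i] elements from [G] to [x]. *)
Lemma star_iter_meet i j G H x : star_iter i G x -> star_iter j H x ->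
  exists2 y, H y & star_iter (i + j) G y.
Proof.
elim: j i x => [i x Gx Hx|j IH i x Gx /star_iterS[B [y [UB Bx By Hy]]]].
  by exists x; rewrite ?addn0.
by rewrite addnS -addSn; apply: IH Hy; apply: (star_iterS_mem UB Bx By Gx).
Qed.

Lemma star_iter_leq i j G : is_cover U -> (i <= j)%N ->
  star_iter i G `<=` star_iter j G.
Proof.
move=> cU /subnK<-; elim: (j - i)%N => // k IH x /IH Gx.
have [B UB Bx] := mem_cover x cU.
exact: (star_iterS_mem UB Bx Bx Gx).
Qed.

Lemma unif_bounded_star_iter (L : large_scale_structure X) m
    (W : set (set X)) : unif_bounded L U -> unif_bounded L W ->
  unif_bounded L [set star_iter m B | B in W].
Proof.
move=> bU bW; elim: m => [|m IH]; first by rewrite image_id.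
have -> : [set star_iter m.+1 B | B in W] =
    [set family_star B U | B in [set star_iter m B | B in W]].
  by rewrite image_comp.
exact: unif_bounded_star.
Qed.

Lemma is_cover_star_iter m (W : set (set X)) : is_cover U -> is_cover W ->
  is_cover [set star_iter m C | C in W].
Proof.
move=> cU cW; apply/seteqP; split=> // x _.
have [C WC Cx] : (\bigcup_(C in W) C) x by rewrite cW.
exists (star_iter m C); first by exists C.
exact: (@star_iter_leq 0%N).
Qed.

End IteratedStars.

(** Applying the dimension bound to the enlarged cover of [m]-fold stars makes it
    hold at scale [m]: the [m]-fold stars of the elements of the resulting cover
    still overlap at most [n.+1] times. *)
Lemma asdim_star_cover (X : Type) (L : large_scale_structure X) (n m : nat)
    (U : set (set X)) : asdim_le L n -> unif_bounded_cover L U ->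
  exists2 W, unif_bounded_cover L W & forall B, U B ->
    (W `&` [set C | C `&` star_iter U m B !=set0] #<= `I_n.+1)%card.
Proof.
move=> hdim [bU cU]; have [|W WL W_meet] := hdim [set star_iter U m B | B in U].
  by split; [exact: unif_bounded_star_iter|exact: is_cover_star_iter].
by exists W => // B UB; apply: W_meet; exists B.
Qed.

(** * Tent functions *)

Section Tents.
Context {R : realType} {X : Type} (U : set (set X)) (m : nat).
Implicit Types (G : set X) (x y : X).

(** This is [max (0, 1 - d / m.+1)] with [d] the length of a shortest chain of
    elements of [U] from [G] to [x]. Counting the stars that contain [x] avoids
    mentioning [d], which need not be finite. *)
Definition tent G x : R := (\sum_(j < m.+1) \1_(star_iter U j G) x) / m.+1%:R.

Let ind_ge0 (A : set X) x : 0 <= \1_A x :> R.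
Proof. by rewrite indicE ler0n. Qed.

Lemma tent_ge0 G x : 0 <= tent G x.
Proof. by rewrite divr_ge0 ?sumr_ge0. Qed.

Lemma tent_le1 G x : tent G x <= 1.
Proof.
rewrite ler_pdivrMr// mul1r -[leRHS](_ : \sum_(j < m.+1) 1 = _).
  by apply: ler_sum => j _; rewrite indicE; case: (_ \in _).
by rewrite sumr_const card_ord.
Qed.

Hypothesis cU : is_cover U.

Lemma tent_eq1 G x : G x -> tent G x = 1.
Proof.
move=> Gx; rewrite /tent (eq_bigr (fun=> 1)) ?sumr_const ?card_ord ?divff//.
move=> j _; rewrite indicE mem_set//.
exact: (@star_iter_leq _ _ 0%N).
Qed.

Lemma tent_lt1 G x : ~ G x -> tent G x < 1.
Proof.
move=> Gx; rewrite ltr_pdivrMr// mul1r big_ord_recl/= indicE memNset//.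
rewrite mulr0n add0r (@le_lt_trans _ _ m%:R) ?ltr_nat//.
rewrite -[leRHS](_ : \sum_(j < m) 1 = _).
  by apply: ler_sum => j _; rewrite indicE; case: (_ \in _).
by rewrite sumr_const card_ord.
Qed.

Lemma tent_gt0 G x : star_iter U m G x -> 0 < tent G x.
Proof.
move=> Gx; rewrite divr_gt0// big_ord_recr/= indicE mem_set//.
by rewrite ltr_wpDl ?sumr_ge0// => i _.
Qed.

Lemma tent_neq0 G x : tent G x != 0 -> star_iter U m G x.
Proof.
apply: contraNP => Gx; rewrite /tent big1 ?mul0r// => j _.
rewrite indicE memNset// => Gj; apply: Gx; apply: (star_iter_leq cU _ Gj).
by rewrite -ltnS.
Qed.

(** The [j]-fold star at [x] lies in the [j.+1]-fold star at [y]: shifting the index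
    by one loses only the last term of the sum. *)
Let tent_lip_le G B x y : U B -> B x -> B y ->
  tent G x <= tent G y + m.+1%:R^-1.
Proof.
move=> UB Bx By; rewrite /tent -[X in _ + X]mul1r -mulrDl ler_wpM2r//.
rewrite big_ord_recr/= [in leRHS]big_ord_recl/= [leRHS]addrAC [leRHS]addrC.
apply: lerD; last by rewrite ler_wpDl// indicE; case: (_ \in _).
apply: ler_sum => i _; rewrite !indicE ler_nat; case: (boolP (x \in _)) => //.
by move=> /set_mem xG; rewrite mem_set//=; apply: (star_iterS_mem UB Bx By xG).
Qed.

Lemma tent_lip G B x y : U B -> B x -> B y ->
  `|tent G x - tent G y| <= m.+1%:R^-1.
Proof.
move=> UB Bx By; rewrite ler_norml lerBlDl (tent_lip_le _ UB)//.
by rewrite lerNl opprB lerBlDl (tent_lip_le _ UB).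
Qed.

End Tents.

(** * Simplicial complexes and skeleta *)

Section Complexes.
Context {R : realType} {S : choiceType}.
Implicit Types (p q r : S -> R) (v : S) (s : set S) (K : set (S -> R)).

Lemma supp_neq0 p : full_complex p -> supp p !=set0.
Proof.
move=> [fp _ p1]; apply/set0P/negP => /eqP p0; move: p1.
rewrite -[LHS]/(mass p) (@mass_fset _ _ fset0) ?big_nil; last by rewrite p0.
by move/esym/eqP; rewrite oner_eq0.
Qed.

(** Pigeonhole: at most [n.+1] coordinates share a total mass of [1]. *)
Lemma dominant_vertex (n : nat) p : full_complex p ->
  (supp p #<= `I_n.+1)%card -> exists v, n.+1%:R^-1 <= p v.
Proof.
move=> fullp pn; apply: contrapT => /forallNP small.
have [v0 v0p] := supp_neq0 fullp; have [fp p01 p1] := fullp.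
suff : mass p < 1 by rewrite /mass p1 ltxx.
rewrite (@mass_fset _ _ (fset_set (supp p))); last exact: supp_fset_set.
apply: (@lt_le_trans _ _ (\sum_(v <- fset_set (supp p)) n.+1%:R^-1)).
  apply: ltr_sum => [|v _]; last by rewrite ltNge; apply/negP/small.
  by apply/hasP; exists v0 => //; rewrite in_fset_set// mem_set.
rewrite big_const_seq count_predT iter_addr_0 -[leLHS]mulr_natl ler_pdivrMr//.
by rewrite mul1r ler_nat geq_card_fset_set.
Qed.

(** A vertex carrying a share [1 / n.+1] of [p] survives in every point reached from
    [p] by two moves that are each shorter than half of this share. *)
Lemma heavy_vertex_persists (n : nat) (delta : R) p q r v :
  full_complex p -> full_complex q -> full_complex r ->
  n.+1%:R^-1 <= p v -> delta < (2 * n.+1%:R)^-1 ->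
  l1dist p q <= delta -> l1dist q r <= delta -> 0 < q v /\ 0 < r v.
Proof.
move=> [fp _ _] [fq _ _] [fr _ _] pv dn pq qr.
have := coord_le_l1dist v fp fq; have := coord_le_l1dist v fq fr.
rewrite !ler_norml => /andP[_ qrv] /andP[_ pqv].
have c2 : 2 * (2 * n.+1%:R)^-1 = n.+1%:R^-1 :> R.
  by rewrite invfM mulrA divff// mul1r.
have c0 : 0 < n.+1%:R^-1 :> R by rewrite invr_gt0.
move: c0 c2 pv dn; move: (n.+1%:R^-1) ((2 * n.+1%:R)^-1) => c d *.
by split; lra.
Qed.

Lemma complex_full K p : simplicial_complex K -> K p -> full_complex p.
Proof. by move=> [F _ ->] [s _ []]. Qed.

Lemma complex_face K p s : simplicial_complex K -> K p -> is_simplex s ->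
  s `<=` supp p -> simplices K s.
Proof.
move=> [F FS ->] [t Ft [fp pt]] ss sp; split=> // q [fq qs].
by exists t => //; split=> // v /qs/sp/pt.
Qed.

Lemma skeleton_sub (n : nat) K : skeleton n K `<=` K.
Proof. by move=> p [s [[_ sK] _]] /sK. Qed.

Lemma skeleton_supp (n : nat) K p : skeleton n K p ->
  (supp p #<= `I_n.+1)%card.
Proof.
move=> [s [_ sn] [_ ps]].
exact: card_le_trans (subset_card_le ps) sn.
Qed.

Lemma skeleton_carrier (n : nat) K p q : simplicial_complex K -> K p ->
  full_complex q -> supp q `<=` supp p -> (supp q #<= `I_n.+1)%card ->
  skeleton n K q.
Proof.
move=> sK Kp fq qp qn; exists (supp q) => //; split=> //.
by apply: complex_face qp => //; split; [case: fq|exact: supp_neq0].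
Qed.

Lemma supp_vertex v : supp (\1_[set v] : S -> R) `<=` [set v].
Proof.
by move=> w; apply: contraPP => wv; apply/negP; rewrite negbK indicE memNset.
Qed.

Lemma full_complex_vertex v : full_complex (\1_[set v] : S -> R).
Proof.
have sv := @supp_vertex v.
split; first exact: sub_finite_set sv _.
- by move=> w; rewrite indicE; case: (_ \in _); rewrite ?lexx ?ler01.
- rewrite -[LHS]/(mass _) (@mass_fset _ _ [fset v]%fset).
    by rewrite big_seq_fset1 indicE mem_set.
  by move=> w /sv ->; rewrite /= inE.
Qed.

Lemma vertices_skeleton (n : nat) K p v : simplicial_complex K -> K p ->
  p v != 0 -> vertices (skeleton n K) v.
Proof.
move=> sK Kp pv; have sv := @supp_vertex v.
apply: (skeleton_carrier sK Kp); first exact: full_complex_vertex.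
  by move=> w /sv ->.
apply: card_le_trans (subset_card_le sv) _.
by rewrite (card_le_eql card_set1) card_le_II.
Qed.

End Complexes.

(** * Interpolation near and away from the prescribed part *)

Section Blend.
Context {R : realType} {X : Type} {S : choiceType}.
Context (U : set (set X)) (m n : nat) (delta : R) (A : set X).
Context (f : X -> S -> R) (a : X -> X) (G : S -> set X).

(** The value at [x] cut down to the value at the base point [a x]; near [A] the
    base point lies in [A], whence at most [n.+1] vertices remain. *)
Let hub x : S -> R := fun v => Num.min (f x v) (f (a x) v).

(** Interpolation, driven by the depth of [x] around [A], between the [hub] and the
    nerve-type map sending [x] to the combination of the vertices [v] weighted by
    the depth of [x] around [G v]. *)
Definition blend (x : X) : S -> R := fun v =>
  tent U m A x * hub x v + (1 - tent U m A x) * tent U m (G v) x.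

Let D x : set S := [set v | star_iter U m (G v) x].

Hypotheses (cU : is_cover U) (f_full : forall x, full_complex (f x)).
Hypothesis f_varU : forall B x y, U B -> B x -> B y ->
  l1dist (f x) (f y) <= delta.
Hypotheses (a_id : forall x, A x -> a x = x)
  (a_in : forall x, star_iter U m A x -> A (a x))
  (a_close : forall x, l1dist (f x) (f (a x)) <= delta).
Hypothesis f_skel : forall x, A x -> (supp (f x) #<= `I_n.+1)%card.
(** By [G_f] and [G_a], on the collar around [A] the vertices attached to the
    regions around [x] belong to the support of the [hub] of [x], so that the
    interpolation does not enlarge the simplex. *)
Hypotheses
  (G_f : forall v x, star_iter U m (G v) x -> 0 < f x v)
  (G_a : forall v x, star_iter U m (G v) x -> star_iter U m A x ->
    0 < f (a x) v)
  (G_cover : forall x, exists v, G v x)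
  (G_card : forall x, (D x #<= `I_n.+1)%card).
Hypotheses (m_gt0 : (0 < m)%N) (delta_small : delta < (2 * n.+1%:R)^-1).

Let f_ge0 x v : 0 <= f x v.
Proof. by have [_ /(_ v)/andP[]] := f_full x. Qed.

Let f_fin x : finite_set (supp (f x)).
Proof. by have [] := f_full x. Qed.

Let hub_ge0 x v : 0 <= hub x v.
Proof. by rewrite le_min !f_ge0. Qed.

Let hub_fin x : finite_set (supp (hub x)).
Proof. exact: finite_supp_min. Qed.

Let tent_D x v : tent U m (G v) x <= \1_(D x) v :> R.
Proof.
rewrite indicE; case: (boolP (v \in _)) => [_|]; first exact: tent_le1.
rewrite notin_setE => nD; have [->//|/eqP] := eqVneq (tent U m (G v) x : R) 0.
by move=> /eqP/(tent_neq0 cU).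
Qed.

Let D_fin x : finite_set (D x).
Proof. by apply/finite_set_leP; exists n.+1. Qed.

Let supp_D x : supp (\1_(D x) : S -> R) `<=` D x.
Proof.
by move=> w; apply: contraPP => wv; apply/negP; rewrite negbK indicE memNset.
Qed.

Let supp_Dfin x : finite_set (supp (\1_(D x) : S -> R)).
Proof. exact: sub_finite_set (@supp_D x) _. Qed.

Let mass_D x : mass (\1_(D x) : S -> R) <= n.+1%:R.
Proof.
rewrite -[leRHS]mulr1; apply: mass_le_card (@supp_D x) (G_card x) _ _ => //.
Qed.

Let supp_cloud x : supp (fun v => tent U m (G v) x : R) `<=` D x.
Proof. by move=> v /(tent_neq0 cU). Qed.

Let cloud_fin x : finite_set (supp (fun v => tent U m (G v) x : R)).
Proof. exact: sub_finite_set (@supp_cloud x) _. Qed.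

Lemma blend_ge0 x v : 0 <= blend x v.
Proof.
by rewrite addr_ge0// mulr_ge0 ?tent_ge0 ?hub_ge0// subr_ge0 tent_le1.
Qed.

Lemma blend_fin x : finite_set (supp (blend x)).
Proof.
apply: (finite_supp2 (hub_fin x) (cloud_fin x)) => v h0 c0.
by rewrite /blend h0 c0 !mulr0 addr0.
Qed.

Lemma supp_blend x : supp (blend x) `<=` supp (f x).
Proof.
move=> v; apply: contraPP => /negP; rewrite negbK => /eqP f0.
apply/negP; rewrite negbK /blend /hub f0 min_l ?f_ge0// mulr0 add0r.
have [->|/(tent_neq0 cU)/G_f] := eqVneq (tent U m (G v) x : R) 0.
  by rewrite mulr0.
by rewrite f0 ltxx.
Qed.

(** Away from [A] only the regions around [x] contribute, and there are at most
    [n.+1] of them; near [A] every contributing vertex lies in the support of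
    [f (a x)], where [a x] is a point of [A]. *)
Lemma supp_blend_card x : (supp (blend x) #<= `I_n.+1)%card.
Proof.
have [A0|/(tent_neq0 cU) Ax] := eqVneq (tent U m A x : R) 0.
  apply: card_le_trans (G_card x); apply: subset_card_le => v.
  rewrite /supp/= /blend A0 mul0r add0r subr0 mul1r.
  exact: tent_neq0.
apply: card_le_trans (f_skel (a_in Ax)); apply: subset_card_le => v.
apply: contraPP => /negP; rewrite negbK => /eqP f0.
apply/negP; rewrite negbK /blend /hub f0 min_r ?f_ge0// mulr0 add0r.
have [->|/(tent_neq0 cU)/G_a/(_ Ax)] := eqVneq (tent U m (G v) x : R) 0.
  by rewrite mulr0.
by rewrite f0 ltxx.
Qed.

Lemma blend_id x : A x -> blend x = f x.
Proof.
move=> Ax; apply/funext => v.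
by rewrite /blend (tent_eq1 m cU)// subrr mul0r addr0 mul1r /hub a_id// minxx.
Qed.

Let delta_half : delta <= 2^-1.
Proof.
apply: le_trans (ltW delta_small) _; rewrite lef_pV2 ?posrE ?mulr_gt0//.
by rewrite -[leLHS]mulr1 ler_pM2l// ler1n.
Qed.

Let hub_dist x : l1dist (f x) (hub x) <= delta.
Proof. exact: le_trans (l1dist_min (f_fin x) (f_fin (a x))) (a_close x). Qed.

Let mass_f x : mass (f x) = 1.
Proof. by have [] := f_full x. Qed.

Lemma mass_blend x : 2^-1 <= mass (blend x).
Proof.
have hubm : 2^-1 <= mass (hub x).
  have := mass_le_l1dist (f_fin x) (hub_fin x).
  rewrite mass_f => /le_trans/(_ (hub_dist x)).
  rewrite ler_norml => /andP[_]; have := delta_half; lra.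
have cloudm : 1 <= mass (fun v => tent U m (G v) x : R).
  have [v Gx] := G_cover x.
  rewrite -(tent_eq1 (R := R) m cU Gx).
  apply: (coord_le_mass (p := fun v => tent U m (G v) x) v) => // w.
  exact: tent_ge0.
rewrite /blend massD.
- rewrite !massZ; have := tent_ge0 (R := R) U m A x.
  by have := tent_le1 (R := R) U m A x; nra.
- by apply: (finite_supp2 (hub_fin x) (hub_fin x)) => v -> _; rewrite mulr0.
- by apply: (finite_supp2 (cloud_fin x) (cloud_fin x)) => v -> _; rewrite mulr0.
Qed.

(** Up to the error [hub_dist] at both ends the hubs vary like [f]; each of the
    tents varies by [1 / m.+1], and at most [n.+1] of them are nonzero at a point. *)
Lemma blend_dist B x y : U B -> B x -> B y ->
  l1dist (blend x) (blend y) <=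
    3 * delta + m.+1%:R^-1 * (1 + 3 * n.+1%:R).
Proof.
move=> UB Bx By; set r := m.+1%:R^-1.
have r0 : 0 <= r :> R by rewrite invr_ge0.
pose d1 v := `|f x v - hub x v|; pose d2 v := `|f x v - f y v|.
pose d3 v := `|f y v - hub y v|.
have fd1 : finite_set (supp d1) by exact: finite_supp_dist.
have fd2 : finite_set (supp d2) by exact: finite_supp_dist.
have fd3 : finite_set (supp d3) by exact: finite_supp_dist.
pose e1 v : R := d2 v + d3 v; pose e2 v : R := d1 v + e1 v.
pose e3 v : R := \1_(D x) v + 2 * \1_(D y) v; pose e4 v : R := f y v + e3 v.
have fe1 : finite_set (supp e1).
  by apply: (finite_supp2 fd2 fd3) => v; rewrite /e1 => -> ->; rewrite addr0.
have fe2 : finite_set (supp e2).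
  by apply: (finite_supp2 fd1 fe1) => v; rewrite /e2 => -> ->; rewrite addr0.
have f2D : finite_set (supp (fun v => 2 * \1_(D y) v : R)).
  by apply: (finite_supp2 (supp_Dfin y) (supp_Dfin y)) => v -> _; rewrite mulr0.
have fe3 : finite_set (supp e3).
  apply: (finite_supp2 (supp_Dfin x) (supp_Dfin y)) => v.
  by rewrite /e3 => -> ->; rewrite mulr0 addr0.
have fe4 : finite_set (supp e4).
  by apply: (finite_supp2 (f_fin y) fe3) => v; rewrite /e4 => -> ->; rewrite addr0.
have fre4 : finite_set (supp (fun v => r * e4 v)).
  by apply: (finite_supp2 fe4 fe4) => v -> _; rewrite mulr0.
apply: (@le_trans _ _ (mass (fun v => e2 v + r * e4 v))).
  apply: le_mass.
  - by apply: finite_supp_dist; exact: blend_fin.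
  - by apply: (finite_supp2 fe2 fre4) => v -> ->; rewrite addr0.
  - move=> v.
    have tA := tent_lip (R := R) m A UB Bx By.
    have tG : `|tent U m (G v) x - tent U m (G v) y| <=
        r * (\1_(D x) v + \1_(D y) v).
      have := tent_lip (R := R) m (G v) UB Bx By.
      rewrite -/r !ler_norml => /andP[tG1 tG2].
      have := tent_D x v; have := tent_D y v; rewrite !indicE.
      have := tent_ge0 (R := R) U m (G v) x; have := tent_ge0 (R := R) U m (G v) y.
      case: (v \in D x); case: (v \in D y) => /= *;
        apply/andP; split; lra.
    have hubf : hub y v <= f y v by rewrite ge_min lexx.
    have hubd : `|hub x v - hub y v| <= e2 v.
      have -> : hub x v - hub y v =
        - (f x v - hub x v) + ((f x v - f y v) + (f y v - hub y v)) by ring.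
      rewrite (le_trans (ler_normD _ _))// normrN lerD2l.
      exact: ler_normD.
    have hx := hub_ge0 x v; have hy := hub_ge0 y v.
    have tDy := tent_D y v; have ty := tent_ge0 (R := R) U m (G v) y.
    have s0 := tent_ge0 (R := R) U m A x; have s1 := tent_le1 (R := R) U m A x.
    (* abstracting all tents and coordinates leaves an inequality on reals *)
    rewrite /blend /e4 /e3; move: tA tG hubd tDy ty s0 s1 hubf hx hy; rewrite -/r.
    move: (tent U m A x) (tent U m A y) (tent U m (G v) x) (tent U m (G v) y).
    move: (\1_(D x) v) (\1_(D y) v) (hub x v) (hub y v) (f y v) (e2 v).
    move=> Dx Dy hx hy fy e sx sy gx gy tA tG hubd tDy ty s0 s1 hubf hx0 hy0.
    have -> : sx * hx + (1 - sx) * gx - (sy * hy + (1 - sy) * gy) =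
      sx * (hx - hy) + (sx - sy) * hy + ((1 - sx) * (gx - gy) - (sx - sy) * gy).
      by ring.
    have b1 : `|sx * (hx - hy)| <= e.
      rewrite normrM (ger0_norm s0) (le_trans _ hubd)//.
      by rewrite -[leRHS]mul1r ler_wpM2r.
    have b2 : `|(sx - sy) * hy| <= r * fy.
      by rewrite normrM (ger0_norm hy0) ler_pM.
    have b3 : `|(1 - sx) * (gx - gy)| <= r * (Dx + Dy).
      rewrite normrM ger0_norm ?subr_ge0// (le_trans _ tG)//.
      by rewrite -[leRHS]mul1r ler_wpM2r// gerBl.
    have b4 : `|(sx - sy) * gy| <= r * Dy.
      by rewrite normrM (ger0_norm ty) ler_pM.
    have := ler_normD (sx * (hx - hy) + (sx - sy) * hy)
      ((1 - sx) * (gx - gy) - (sx - sy) * gy).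
    have := ler_normD (sx * (hx - hy)) ((sx - sy) * hy).
    have := ler_normB ((1 - sx) * (gx - gy)) ((sx - sy) * gy).
    lra.
rewrite massD// massZ !massD// massZ mass_f; apply: lerD.
  have := hub_dist x; have := hub_dist y; have := f_varU UB Bx By.
  by rewrite /l1dist -![\sum_(v \in [set: S]) _]/(mass _) -/d1 -/d2 -/d3; lra.
apply: ler_wpM2l => //; have := mass_D x; have := mass_D y.
move: (mass _) (mass _) n.+1%:R => *. lra.
Qed.

(** If [B] meets [A], a dominant vertex at a common point persists in all hubs over
    [B], and the hubs have positive weight there. Otherwise the weight of the
    nerve-type map is positive on [B], and any region meeting [B] will do. *)
Lemma blend_lebesgue B x0 : U B -> B x0 ->
  exists v, forall y, B y -> 0 < blend y v.
Proof.
move=> UB Bx0; have [[b Bb Ab]|nBA] := pselect (exists2 b, B b & A b).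
  have [v fv] := dominant_vertex (f_full b) (f_skel Ab).
  exists v => y By.
  have [fyv fayv] := heavy_vertex_persists (f_full b) (f_full y) (f_full (a y))
    fv delta_small (f_varU UB Bb By) (a_close y).
  have tAy : 0 < tent U m A y :> R.
    apply: tent_gt0 => //; apply: (star_iter_leq cU m_gt0).
    exact: (star_iterS_mem (m := 0) UB Bb By).
  apply: ltr_pwDl; first by rewrite mulr_gt0// lt_min fyv.
  by rewrite mulr_ge0 ?tent_ge0// subr_ge0 tent_le1.
have [v Gv] := G_cover x0; exists v => y By.
apply: ltr_wpDl; first by rewrite mulr_ge0 ?tent_ge0 ?hub_ge0.
rewrite mulr_gt0//.
  by rewrite subr_gt0; apply: tent_lt1 => // Ay; apply: nBA; exists y.
apply: tent_gt0 => //; apply: (star_iter_leq cU m_gt0).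
exact: (star_iterS_mem (m := 0) UB Bx0 By).
Qed.

End Blend.

(** * Existence of fillers *)

Section CoverVariation.
Context {R : realType} {X M : Type} (d : M -> M -> R) (U : set (set X)).
Implicit Type f : X -> M.

Lemma cover_variation_ub f e B x y : (cover_variation d U f < e%:E)%E ->
  U B -> B x -> B y -> d (f x) (f y) <= e.
Proof.
move=> fe UB Bx By; rewrite -lee_fin; apply: le_trans (ltW fe).
by apply: ereal_sup_ubound; exists B, x, y.
Qed.

Lemma cover_variation_lt f e c : c < e ->
  (forall B x y, U B -> B x -> B y -> d (f x) (f y) <= c) ->
  (cover_variation d U f < e%:E)%E.
Proof.
move=> ce fc; apply: (@le_lt_trans _ _ c%:E); last by rewrite lte_fin.
apply: ge_ereal_sup => _ [B [x [y [UB Bx By ->]]]].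
by rewrite lee_fin (fc B).
Qed.

End CoverVariation.

(** The bound is [blend_dist] multiplied by the factor 4 of [l1dist_normalize]; the
    choice below makes it at most [eps / 2]. *)
Lemma small_scales (R : realType) (n : nat) (eps : R) : 0 < eps ->
  exists (delta : R) (m : nat), [/\ 0 < delta, (0 < m)%N,
    delta < (2 * n.+1%:R)^-1 &
    4 * (3 * delta + m.+1%:R^-1 * (1 + 3 * n.+1%:R)) < eps].
Proof.
move=> eps0; pose N : R := n.+1%:R; have N0 : 0 < N by [].
have c0 : 0 < 16 * (1 + 3 * N) / eps.
  by rewrite divr_gt0// mulr_gt0// addr_gt0// mulr_gt0.
exists (Num.min (4 * N)^-1 (eps / 48)), (Num.bound (16 * (1 + 3 * N) / eps)).+1.
split => //.
- by rewrite lt_min invr_gt0 mulr_gt0// divr_gt0.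
- by rewrite gt_min ltf_pV2 ?posrE ?mulr_gt0// ltr_pM2r// ltr_nat.
set m := (Num.bound _).+1.
have mc : 16 * (1 + 3 * N) / eps < m.+1%:R.
  apply: lt_trans (archi_boundP (ltW c0)) _; rewrite ltr_nat /m.
  exact: leqW.
have b : m.+1%:R^-1 * (1 + 3 * N) <= eps / 16.
  rewrite ler_pdivrMl//.
  by move: mc; rewrite ltr_pdivrMr// => /ltW; lra.
have : Num.min (4 * N)^-1 (eps / 48) <= eps / 48.
  by rewrite ge_min lexx orbT.
move: b; rewrite -/N; move: (Num.min _ _) (m.+1%:R^-1 * _) => d t.
lra.
Qed.

Theorem theorem4p3 (R : realType) (X : Type) (L : large_scale_structure X)
    (n : nat) (hdim : asdim_le L n) :
  forall (eps : R) (U : set (set X)), 0 < eps -> unif_bounded_cover L U ->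
  exists (delta : R) (V : set (set X)),
    [/\ 0 < delta, unif_bounded_cover L V &
    forall (S : choiceType) (K : set (S -> R)) (A : set X)
           (f g : X -> S -> R),
      simplicial_complex K ->
      is_partition_of_unity L V delta K f ->
      set_fun A (skeleton n K) g ->
      (forall x, A x -> f x = g x) ->
    exists h : X -> S -> R,
      is_partition_of_unity L U eps (skeleton n K) h /\
      is_filler K A f g h].
Proof.
move=> eps U eps0 [bU cU].
have [delta [m [delta0 m0 delta_small scale]]] := small_scales n eps0.
have [W [bW cW] W_meet] := asdim_star_cover m hdim (conj bU cU).
(* a point within [m] steps of both [C] and [A] leads to a point of [A] within
   [m + m] steps of [C] *)
pose V0 := [set star_iter U (m + m) C | C in W].
(* the empty set supplies a vertex of [K], also when [X] is empty *)
exists delta, (V0 `|` [set set0]); split=> //.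
  split.
    apply: (unif_bounded_refine (unif_bounded_star_iter (m + m) bU bW)).
    move=> B [V0B|->] nB; first by exists B.
    by exfalso; apply: nB => ? ? [].
  apply/seteqP; split=> // x _; have [C [D WD DC] Cx] :=
    mem_cover x (is_cover_star_iter (m + m) cU cW).
  by exists C => //; left; exists D.
move=> S K A f g sK [fK f_var f_leb [f_bd f_cov]] gA fgA.
have Kf x : K (f x) by exact: fK.
have f_full x : full_complex (f x) by exact: complex_full (Kf x).
have f_ge0 x v : 0 <= f x v by have [_ /(_ v)/andP[]] := f_full x.
have f_fin x : finite_set (supp (f x)) by have [] := f_full x.
have f_near C x y : W C -> star_iter U (m + m) C x ->
    star_iter U (m + m) C y -> l1dist (f x) (f y) <= delta.
  move=> WC Cx Cy.
  by apply: (cover_variation_ub f_var _ Cx Cy); left; exists C.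
have sub_star j C : (j <= m + m)%N ->
    star_iter U j C `<=` star_iter U (m + m) C.
  exact: star_iter_leq.
have f_varU B x y : U B -> B x -> B y -> l1dist (f x) (f y) <= delta.
  move=> UB Bx By; have [C WC Cx] := mem_cover x cW.
  apply: (f_near C) => //; first exact: (sub_star 0%N).
  apply: (sub_star 1%N); first by rewrite addn_gt0 m0.
  exact: (star_iterS_mem (m := 0) UB Bx By).
have f_skel x : A x -> (supp (f x) #<= `I_n.+1)%card.
  by move=> Ax; rewrite fgA//; apply: skeleton_supp (gA _ Ax).
(* the base point of [x]: a point of [A] in a common element of [V0] if [x] is
   close to [A], equal to [x] when [x] is in [A] or far from [A] *)
have [a aP] : {a : X -> X & forall x, [/\ A x -> a x = x,
    star_iter U m A x -> A (a x) & l1dist (f x) (f (a x)) <= delta]}.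
  apply: (@choice _ _ (fun x y => [/\ A x -> y = x,
    star_iter U m A x -> A y & l1dist (f x) (f y) <= delta])) => x.
  have [C WC Cx] := mem_cover x cW.
  have [B UB Bx] := mem_cover x cU.
  have [Ax|nAx] := pselect (A x).
    by exists x; split=> //; exact: (f_varU B).
  have [sAx|nsAx] := pselect (star_iter U m A x); last first.
    by exists x; split=> //; exact: (f_varU B).
  have [y Ay Cy] := @star_iter_meet _ U 0 m C A x Cx sAx.
  exists y; split=> //; apply: (f_near C) => //; first exact: (sub_star 0%N).
  by apply: sub_star Cy; rewrite add0n leq_addr.
have [v0 Kv0 _] := f_leb set0 (or_intror erefl).
(* [w C] is a dominant vertex at a point of [A] close to [C] if there is one, and
   otherwise a vertex given by the Lebesgue property of [f] *)
have [w wP] : {w : set X -> S & forall C, W C -> forall x,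
    star_iter U m C x ->
    0 < f x (w C) /\ (star_iter U m A x -> 0 < f (a x) (w C))}.
  apply: (@choice _ _ (fun C v => W C -> forall x, star_iter U m C x ->
    0 < f x v /\ (star_iter U m A x -> 0 < f (a x) v))) => C.
  have [WC|nWC] := pselect (W C); last by exists v0.
  have mm : (m <= m + m)%N by rewrite leq_addr.
  have [[b Ab Cb]|nCA] := pselect (exists2 b, A b & star_iter U (m + m) C b).
    have [v fv] := dominant_vertex (f_full b) (f_skel b Ab).
    exists v => _ x Cx; have [_ _ ax] := aP x.
    have bx := f_near C b x WC Cb (sub_star m C mm x Cx).
    have [xv axv] := heavy_vertex_persists (f_full b) (f_full x) (f_full (a x))
      fv delta_small bx ax.
    by split.
  have [v _ fv] := f_leb (star_iter U (m + m) C)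
    (or_introl (ex_intro2 _ _ C WC erefl)).
  exists v => _ x Cx; split=> [|Ax]; first by apply: fv; exact: sub_star Cx.
  by case: nCA; have [y Ay Cy] := star_iter_meet Cx Ax; exists y.
(* grouping the elements of [W] by their vertex replaces a sum over [W] by a single
   tent for each vertex *)
pose G v := \bigcup_(C in W `&` [set C | w C = v]) C.
have G_mem v x : star_iter U m (G v) x ->
    exists C, [/\ W C, w C = v & star_iter U m C x].
  by move=> Gx; have [C [WC wC] Cx] := star_iter_bigcup Gx; exists C.
have G_f v x : star_iter U m (G v) x -> 0 < f x v.
  by move=> /G_mem[C [WC <- Cx]]; have [] := wP C WC x Cx.
have G_a v x : star_iter U m (G v) x -> star_iter U m A x -> 0 < f (a x) v.
  by move=> /G_mem[C [WC <- Cx]]; have [_] := wP C WC x Cx; apply.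
have G_cover x : exists v, G v x.
  by have [C WC Cx] := mem_cover x cW; exists (w C); exists C.
have G_card x : ([set v | star_iter U m (G v) x] #<= `I_n.+1)%card.
  have [B UB Bx] := mem_cover x cU.
  apply: card_le_trans (W_meet B UB).
  apply: card_le_trans (card_image_le w _); apply: subset_card_le.
  move=> v /G_mem[C [WC wC Cx]]; exists C => //; split=> //.
  by have [y Cy By] := @star_iter_meet _ U 0 m B C x Bx Cx; exists y.
have a_id x : A x -> a x = x by have [] := aP x.
have a_in x : star_iter U m A x -> A (a x) by have [] := aP x.
have a_close x : l1dist (f x) (f (a x)) <= delta by have [] := aP x.
pose p := blend U m A f a G; pose h x := normalize (p x).
have p_ge0 x v : 0 <= p x v by exact: blend_ge0.
have p_fin x : finite_set (supp (p x)) by exact: (@blend_fin _ _ _ _ _ n).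
have p_mass x : 2^-1 <= mass (p x).
  exact: (@mass_blend _ _ _ U m n delta).
have p_mass0 x : 0 < mass (p x) by apply: lt_le_trans (p_mass x).
have h_full x : full_complex (h x) by exact: full_complex_normalize.
have h_supp x : supp (h x) `<=` supp (f x).
  by apply: subset_trans (@supp_normalize _ _ _) _; exact: supp_blend.
have h_card x : (supp (h x) #<= `I_n.+1)%card.
  apply: card_le_trans (subset_card_le (@supp_normalize _ _ _)) _.
  exact: supp_blend_card.
have h_skel x : skeleton n K (h x) by exact: (skeleton_carrier sK (Kf x)).
exists h; split; last first.
  split=> [x Ax|x s ss [_ fs]]; last by split=> // v /h_supp/fs.
  by rewrite /h /p blend_id// normalize_id// fgA.
split.
- by move=> x _; exact: h_skel.
- apply: (cover_variation_lt scale) => B x y UB Bx By.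
  apply: le_trans (l1dist_normalize (p_fin x) (p_fin y) (p_ge0 y) (p_mass x)
    (p_mass0 y)) _.
  rewrite ler_pM2l//.
  exact: (blend_dist A cU f_full f_varU a_close G_card UB).
- move=> B UB; have [[x0 Bx0]|nB] := pselect (B !=set0); last first.
    exists v0 => [|y By]; last by case: nB; exists y.
    by apply: (vertices_skeleton n sK Kv0); rewrite indicE mem_set// oner_neq0.
  have [v pv] : exists v, forall y, B y -> 0 < p y v.
    exact: (blend_lebesgue cU f_full f_varU a_close f_skel G_cover m0
      delta_small UB Bx0).
  exists v => [|y By]; last by rewrite divr_gt0// pv.
  apply: (vertices_skeleton _ sK (skeleton_sub (h_skel x0)) _).
  by rewrite gt_eqF// divr_gt0// pv.
split.
  apply: (unif_bounded_refine f_bd) => _ [v vK <-] _.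
  exists (f @^-1` vertex_star K v).
    by exists v => //; exact: skeleton_sub vK.
  move=> x [_ hv]; split=> //=.
  by rewrite lt_def f_ge0 andbT; apply: h_supp; rewrite /supp/= gt_eqF.
apply/seteqP; split=> // x _; have [v hv] := supp_neq0 (h_full x).
exists (h @^-1` vertex_star (skeleton n K) v).
  by exists v => //; exact: vertices_skeleton sK (skeleton_sub (h_skel x)) hv.
by split=> //=; rewrite lt_def hv; have [_ /(_ v)/andP[]] := h_full x.
Qed.
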